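(* (1) For every $\Sigma_3$ quantifier-pattern $\bar{\mathsf Q}$ there is $\bar{\mathsf P}$ among the following $3$ patterns with $\langle\bar{\mathsf Q}\rangle\equiv_{\sf m}\langle\bar{\mathsf P}\rangle$: $\exists\forall\exists,\ \forall^\infty\exists^\infty,\ \forall^\infty\exists$. (2) For every $\Pi_3$ quantifier-pattern $\bar{\mathsf Q}$ there is $\bar{\mathsf P}$ among the following $5$ patterns with $\langle\bar{\mathsf Q}\rangle\equiv_{\sf m}\langle\bar{\mathsf P}\rangle$: $\forall\exists\forall,\ \exists^\infty\forall^\infty\forall,\ \exists^\infty\forall,\ \forall\forall^\infty\forall,\ \forall\forall^\infty$. (3) For every $\Pi_3$ quantifier-pattern $\bar{\mathsf Q}$ there is $\bar{\mathsf P}$ among the following $7$ patterns with $\langle\bar{\mathsf Q}\rangle\equiv_{\sf dm}\langle\bar{\mathsf P}\rangle$: $\forall\exists\forall,\ \exists^\infty\exists\forall,\ \exists^\infty\forall^\infty\forall,\ \exists^\infty\forall^\infty,\ \exists^\infty\forall,\ \forall\forall^\infty\forall,\ \forall\forall^\infty$.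
   Context: Quantifiers range over $\omega$. $\exists^\infty n\,\varphi(n)$ means $\forall m\exists n\ge m\,\varphi(n)$ and $\forall^\infty n\,\varphi(n)$ means $\exists m\forall n\ge m\,\varphi(n)$. A quantifier-pattern is a finite nonempty string $\bar{\mathsf Q}=\mathsf Q_0\dots\mathsf Q_\ell$ over $\{\exists,\forall,\exists^\infty,\forall^\infty\}$. Hierarchy of patterns, defined inductively: $\exists,\forall,\exists^\infty,\forall^\infty$ are $\Sigma_1,\Pi_1,\Pi_2,\Sigma_2$ respectively. If $\bar{\mathsf Q}$ is $\Sigma_n$, then $\exists\bar{\mathsf Q},\forall\bar{\mathsf Q},\exists^\infty\bar{\mathsf Q},\forall^\infty\bar{\mathsf Q}$ are $\Sigma_n,\Pi_{n+1},\Pi_{n+1},\Sigma_{n+2}$ respectively. If $\bar{\mathsf Q}$ is $\Pi_n$, then $\exists\bar{\mathsf Q},\forall\bar{\mathsf Q},\exists^\infty\bar{\mathsf Q},\forall^\infty\bar{\mathsf Q}$ are $\Sigma_{n+1},\Pi_n,\Pi_{n+2},\Sigma_{n+1}$ respectively. A $\bar{\mathsf Q}$-formula is $\varphi(\bar x)\equiv\mathsf Q_0n_0\dots\mathsf Q_\ell n_\ell\,\theta(n_0,\dots,n_\ell,\bar x)$ with $\theta$ a bounded formula (all quantifiers bounded; no further parameters). The instance $\bar x$ is a tuple of natural numbers and/or total computable functions (computable elements of $\omega^\omega$). Spaces such as $\omega\times\omega^\omega$, $(\omega^\omega)^\omega$, $\omega^{\omega\times\omega}$ are identified with $\omega^\omega$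 by computable pairing. Witnesses: for $\alpha\in\omega^\omega$, define $\alpha\Vdash\varphi(\bar x)$ (''$\alpha$ is a witness for $\varphi(\bar x)$'') by: $\alpha\Vdash\theta(\bar x)$ iff $\alpha=\bar x$ and $\theta(\bar x)$ holds, for bounded $\theta$; $\langle t,\alpha\rangle\Vdash\exists n\varphi(n,\bar x)$ iff $\alpha\Vdash\varphi(t,\bar x)$; $\alpha\Vdash\forall n\varphi(n,\bar x)$ iff $\alpha(n)\Vdash\varphi(n,\bar x)$ for all $n$; $\langle t,\alpha\rangle\Vdash\forall^\infty n\varphi(n,\bar x)$ iff $\alpha(n)\Vdash\varphi(n,\bar x)$ for all $n\ge t$; $\alpha\Vdash\exists^\infty n\varphi(n,\bar x)$ iff for all $n$, writing $\alpha(n)=\langle k,\beta\rangle$, we have $k\ge n$ and $\beta\Vdash\varphi(k,\bar x)$. Reducibility: $\varphi\le_{\sf m}\psi$ if there are computable functions $\eta,r_-,r_+$ (type-two computable functionals, possibly partial but defined wherever required) such that for every instance $\bar x$: $\varphi(\bar x)$ is true iff $\psi(\eta(\bar x))$ is true; $\alpha\Vdash\varphi(\bar x)$ implies $r_-(\alpha,\bar x)\Vdash\psi(\eta(\bar x))$; $\alpha\Vdash\psi(\eta(\bar x))$ implies $r_+(\alpha,\bar x)\Vdash\varphi(\bar x)$. The witness $\alpha$ is an arbitrary element of $\omega^\omega$. Duals: $\exists,\forall$ are dual to each other and so are $\exists^\infty,\forall^\infty$. The dual $\varphi^{\sf d}$ of $\mathsf Q_0n_0\dots\mathsf Q_\ell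 n_\ell\,\theta$ is $\mathsf Q_0^{\sf d}n_0\dots\mathsf Q_\ell^{\sf d}n_\ell\,\neg\theta$. $\varphi\le_{\sf dm}\psi$ if $\varphi\le_{\sf m}\psi$ and $\varphi^{\sf d}\le_{\sf m}\psi^{\sf d}$ via a common $\eta$ (the realizers $r_\pm$ may differ). $\equiv_{\sf m},\equiv_{\sf dm}$ denote the induced equivalences. $\langle\bar{\mathsf Q}\rangle$ denotes a fixed $\bar{\mathsf Q}$-formula to which every $\bar{\mathsf Q}$-formula is $\le_{\sf dm}$-reducible; concretely $\langle\bar{\mathsf Q}\rangle(x)\equiv\mathsf Q_0n_0\dots\mathsf Q_\ell n_\ell.\ x(n_0,\dots,n_\ell)=0$ (the choice does not matter up to $\equiv_{\sf dm}$). *)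

(* Defs.v *)
From Stdlib Require Import List Arith Cantor.
Import ListNotations.

Set Implicit Arguments.

Definition baire := nat -> nat.

Notation "⟨ a , b ⟩" := (Cantor.to_nat (a, b))
  (at level 0, a at level 99, b at level 99, format "⟨ a ,  b ⟩").

(** * Computability relative to an oracle *)

(** Unary partial recursive functions with an oracle; several arguments are
    passed through the Cantor pairing. *)
Inductive prog : Type :=
| pZero
| pSucc
| pLeft
| pRight
| pOracle
| pPair (f g : prog)
| pComp (f g : prog)
| pPrec (f g : prog)
| pMin (f : prog).

(** [eval o p n v]: with oracle [o], program [p] halts on [n] with value [v].
    - [pPrec f g] maps ⟨a, 0⟩ to f(a) and ⟨a, m+1⟩ to
      g(⟨a, ⟨m, h(⟨a, m⟩)⟩⟩), where h is the function being defined;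
    - [pMin f] maps n to the least v with f(⟨n, v⟩) = 0, all the earlier
      values being defined. *)
Fixpoint eval (o : baire) (p : prog) (n v : nat) : Prop :=
  match p with
  | pZero => v = 0
  | pSucc => v = S n
  | pLeft => v = fst (Cantor.of_nat n)
  | pRight => v = snd (Cantor.of_nat n)
  | pOracle => v = o n
  | pPair f g => exists a b, eval o f n a /\ eval o g n b /\ v = ⟨a, b⟩
  | pComp f g => exists a, eval o g n a /\ eval o f a v
  | pPrec f g =>
      let a := fst (Cantor.of_nat n) in
      (fix iter (m w : nat) : Prop :=
         match m with
         | 0 => eval o f a w
         | S m' => exists c, iter m' c /\ eval o g ⟨a, ⟨m', c⟩⟩ w
         end) (snd (Cantor.of_nat n)) v
  | pMin f =>
      eval o f ⟨n, v⟩ 0 /\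
      forall k, k < v -> exists w, eval o f ⟨n, k⟩ (S w)
  end.

Lemma eval_functional (o : baire) (p : prog) (n v w : nat) :
  eval o p n v -> eval o p n w -> v = w.
Proof.
  revert n v w.
  induction p as [ | | | | | f IHf g IHg | f IHf g IHg | f IHf g IHg | f IHf ];
    cbn [eval]; intros n v w Hv Hw; try congruence.
  - destruct Hv as (a & b & Ha & Hb & ->), Hw as (a' & b' & Ha' & Hb' & ->).
    now rewrite (IHf _ _ _ Ha Ha'), (IHg _ _ _ Hb Hb').
  - destruct Hv as (a & Ha & Hv), Hw as (a' & Ha' & Hw).
    rewrite (IHg _ _ _ Ha Ha') in Hv. exact (IHf _ _ _ Hv Hw).
  - revert v w Hv Hw. generalize (snd (Cantor.of_nat n)) as m.
    induction m as [ | m IHm ]; intros v w Hv Hw; [ now apply (IHf _ _ _ Hv) | ].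
    destruct Hv as (c & Hc & Hv), Hw as (c' & Hc' & Hw).
    rewrite (IHm _ _ Hc Hc') in Hv. exact (IHg _ _ _ Hv Hw).
  - destruct Hv as [Hv Hv'], Hw as [Hw Hw'].
    destruct (Nat.lt_trichotomy v w) as [H | [H | H]]; [ | exact H | ].
    + destruct (Hw' _ H) as [u Hu]. discriminate (IHf _ _ _ Hv Hu).
    + destruct (Hv' _ H) as [u Hu]. discriminate (IHf _ _ _ Hw Hu).
Qed.

(** The partial computable functional of type ω^ω ⇀ ω^ω given by [p] is
    defined at [x] with value [y]. *)
Definition computes (p : prog) (x y : baire) : Prop :=
  forall n, eval x p n (y n).

Definition computable (x : baire) : Prop :=
  exists p, computes p (fun _ => 0) x.

(** * Identifications with ω^ω *)

(** ω × ω^ω: the pair (t, α) is [bcons t α], and [bhd], [btl] are the projections. *)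
Definition bcons (t : nat) (α : baire) : baire :=
  fun n => match n with 0 => t | S k => α k end.
Definition bhd (α : baire) : nat := α 0.
Definition btl (α : baire) : baire := fun n => α (S n).

(** (ω^ω)^ω: the n-th component of α. *)
Definition section (α : baire) (n : nat) : baire := fun k => α ⟨n, k⟩.

(** ω^ω × ω^ω. *)
Definition join (α β : baire) : baire :=
  fun n => if Nat.even n then α (Nat.div2 n) else β (Nat.div2 n).

(** ω^k × ω^ω. *)
Definition tuple (ns : list nat) (x : baire) : baire := fold_right bcons x ns.

(** ω^(l+1), for nonempty lists: a bijection onto ω for each fixed length. *)
Fixpoint code (ns : list nat) : nat :=
  match ns with
  | [] => 0
  | [n] => n
  | n :: ns' => ⟨n, code ns'⟩
  end.

(** * Quantifier patterns *)

Inductive quant : Type := qEx | qAll | qExInf | qAllInf.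

Definition qdual (q : quant) : quant :=
  match q with
  | qEx => qAll
  | qAll => qEx
  | qExInf => qAllInf
  | qAllInf => qExInf
  end.

Inductive level : Type := Sigma (n : nat) | Pi (n : nat).

Definition level_single (q : quant) : level :=
  match q with
  | qEx => Sigma 1
  | qAll => Pi 1
  | qExInf => Pi 2
  | qAllInf => Sigma 2
  end.

Definition level_cons (q : quant) (c : level) : level :=
  match c, q with
  | Sigma n, qEx => Sigma n
  | Sigma n, qAll => Pi (n + 1)
  | Sigma n, qExInf => Pi (n + 1)
  | Sigma n, qAllInf => Sigma (n + 2)
  | Pi n, qEx => Sigma (n + 1)
  | Pi n, qAll => Pi n
  | Pi n, qExInf => Pi (n + 2)
  | Pi n, qAllInf => Sigma (n + 1)
  end.

(** Only nonempty strings, i.e. patterns, have a level. *)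
Inductive has_level : list quant -> level -> Prop :=
| has_level_single q : has_level [q] (level_single q)
| has_level_cons q Q c :
    has_level Q c -> has_level (q :: Q) (level_cons q c).

(** * Formulas, truth and witnesses *)

(** The matrix θ(n_0, …, n_l, x) is represented by the relation it defines;
    its first argument is the list [n_0; …; n_l]. The instance x, possibly a
    tuple, is an element of ω^ω through the identifications above. *)
Record formula : Type := Formula {
  prefix : list quant;
  matrix : list nat -> baire -> Prop
}.

Definition dual (φ : formula) : formula :=
  Formula (map qdual (prefix φ)) (fun ns x => ~ matrix φ ns x).

(** In the next two definitions [ns] lists the values of the quantifiers
    already stripped; it is part of the instance of the remaining formula. *)
Fixpoint truth_at (θ : list nat -> baire -> Prop) (Q : list quant)
    (ns : list nat) (x : baire) : Prop :=
  match Q with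
  | [] => θ ns x
  | qEx :: Q' => exists n, truth_at θ Q' (ns ++ [n]) x
  | qAll :: Q' => forall n, truth_at θ Q' (ns ++ [n]) x
  | qExInf :: Q' =>
      forall m, exists n, m <= n /\ truth_at θ Q' (ns ++ [n]) x
  | qAllInf :: Q' =>
      exists m, forall n, m <= n -> truth_at θ Q' (ns ++ [n]) x
  end.

Fixpoint witness_at (θ : list nat -> baire -> Prop) (Q : list quant)
    (ns : list nat) (x α : baire) : Prop :=
  match Q with
  | [] => (forall k, α k = tuple ns x k) /\ θ ns x
  | qEx :: Q' => witness_at θ Q' (ns ++ [bhd α]) x (btl α)
  | qAll :: Q' => forall n, witness_at θ Q' (ns ++ [n]) x (section α n)
  | qExInf :: Q' =>
      forall n,
        n <= bhd (section α n) /\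
        witness_at θ Q' (ns ++ [bhd (section α n)]) x (btl (section α n))
  | qAllInf :: Q' =>
      forall n, bhd α <= n ->
        witness_at θ Q' (ns ++ [n]) x (section (btl α) n)
  end.

Definition truth (φ : formula) (x : baire) : Prop :=
  truth_at (matrix φ) (prefix φ) [] x.

Definition witness (φ : formula) (x α : baire) : Prop :=
  witness_at (matrix φ) (prefix φ) [] x α.

(** * Reducibility *)

Definition reduces_via (η : prog) (φ ψ : formula) : Prop :=
  exists rm rp : prog,
  forall x, computable x ->
  exists y, computes η x y /\
    (truth φ x <-> truth ψ y) /\
    (forall α, witness φ x α ->
       exists β, computes rm (join α x) β /\ witness ψ y β) /\
    (forall α, witness ψ y α ->
       exists β, computes rp (join α x) β /\ witness φ x β).

Definition m_le (φ ψ : formula) : Prop := exists η, reduces_via η φ ψ.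

Definition dm_le (φ ψ : formula) : Prop :=
  exists η, reduces_via η φ ψ /\ reduces_via η (dual φ) (dual ψ).

Definition m_equiv (φ ψ : formula) : Prop := m_le φ ψ /\ m_le ψ φ.

Definition dm_equiv (φ ψ : formula) : Prop := dm_le φ ψ /\ dm_le ψ φ.

(** ⟨Q⟩(x) ≡ Q_0 n_0 … Q_l n_l. x(n_0, …, n_l) = 0. *)
Definition canonical (Q : list quant) : formula :=
  Formula Q (fun ns x => x (code ns) = 0).

(* Main.v *)
Require Import Defs.
From Stdlib Require Import List Arith Lia Cantor.
From Stdlib Require Import FunctionalExtensionality IndefiniteDescription.
From Stdlib Require Import Setoid Morphisms.
Import ListNotations.

Set Implicit Arguments.

(** The moves [∃∃ ≡ ∃], [∀∃∞ ≡ ∀∃] (shift the last variable by the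
    bound; pad it to come back) and their duals turn every pattern of level at
    most 3 into a normal form, by reductions that serve the dual formulas too.
    Four further reductions hold for witnesses of the formula only: [∃∞ ≤ ∀∃],
    by asking for a value beyond each bound; [∀∃ ≤ ∃∞], by running the
    searches for the inner witnesses one after the other; [∀∃∀ ≤ ∃∞∃∀],
    by choosing witnesses for an initial segment; and [∃∞∀∞ ≤ ∃∞∀],
    by minimizing the bound of [∀∞]. All reductions and realizers can
    be taken total, and by countable choice a formula is true iff it has a
    witness, so that they only have to be checked on witnesses. *)

(** * Total computable functionals *)

Definition unl (n : nat) : nat := fst (Cantor.of_nat n).
Definition unr (n : nat) : nat := snd (Cantor.of_nat n).

Lemma unl_pair (a b : nat) : unl ⟨a, b⟩ = a.
Proof. unfold unl. now rewrite Cantor.cancel_of_to. Qed.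

Lemma unr_pair (a b : nat) : unr ⟨a, b⟩ = b.
Proof. unfold unr. now rewrite Cantor.cancel_of_to. Qed.

Lemma pair_surj (n : nat) : ⟨unl n, unr n⟩ = n.
Proof.
  unfold unl, unr. rewrite <- surjective_pairing. apply Cantor.cancel_to_of.
Qed.

#[local] Hint Rewrite unl_pair unr_pair : unpair.

(** A single program serves all oracles. Keeping the numerical argument visible lets one predicate
    cover functionals [baire -> baire] as well as the terms they are built from. *)
Definition total (f : baire -> nat -> nat) : Prop :=
  exists p, forall o n, eval o p n (f o n).

(** With the arguments in two sections of one oracle, a query to either is a single query at ⟨0, k⟩
    or ⟨1, k⟩; [computes_total2] passes to [join]. *)
Definition total2 (F : baire -> baire -> baire) : Prop :=
  total (fun o => F (section o 0) (section o 1)).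

Lemma total_id : total (fun _ n => n).
Proof.
  exists (pPair pLeft pRight). intros o n. cbn [eval].
  exists (unl n), (unr n). now rewrite pair_surj.
Qed.

Lemma total_comp f g :
  total f -> total g -> total (fun o n => f o (g o n)).
Proof.
  intros [p Hp] [q Hq]. exists (pComp p q). intros o n. cbn. eauto.
Qed.

Lemma total_succ f : total f -> total (fun o n => S (f o n)).
Proof.
  intros Hf. apply (total_comp (f := fun _ n => S n)); [ | exact Hf ].
  now exists pSucc.
Qed.

Lemma total_const c : total (fun _ _ => c).
Proof.
  induction c as [ | c IHc ]; [ now exists pZero | now apply total_succ ].
Qed.

Lemma total_unl f : total f -> total (fun o n => unl (f o n)).
Proof.
  intros Hf. apply (total_comp (f := fun _ n => unl n)); [ | exact Hf ].
  now exists pLeft.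
Qed.

Lemma total_unr f : total f -> total (fun o n => unr (f o n)).
Proof.
  intros Hf. apply (total_comp (f := fun _ n => unr n)); [ | exact Hf ].
  now exists pRight.
Qed.

Lemma total_oracle f : total f -> total (fun o n => o (f o n)).
Proof.
  intros Hf. apply (total_comp (f := fun o n => o n)); [ | exact Hf ].
  now exists pOracle.
Qed.

Lemma total_pair f g :
  total f -> total g -> total (fun o n => ⟨f o n, g o n⟩).
Proof.
  intros [p Hp] [q Hq]. exists (pPair p q). intros o n. cbn. eauto.
Qed.

Lemma total_rect f g h :
  total f -> total (fun o n => g o (unl n) (unl (unr n)) (unr (unr n))) ->
  total h ->
  total (fun o n =>
    nat_rect (fun _ => nat) (f o n) (fun m c => g o n m c) (h o n)).
Proof.
  intros [p Hp] [q Hq] Hh.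
  (* [pPrec] takes parameter and recursion length from one pair; composing with ⟨n, h o n⟩ gives the
     claim. *)
  enough (total (fun o n =>
    nat_rect (fun _ => nat) (f o (unl n)) (fun m c => g o (unl n) m c) (unr n)))
    as Hr.
  { pose proof (total_comp Hr (total_pair total_id Hh)) as H.
    cbv beta in H. destruct H as [r H]. exists r. intros o n.
    specialize (H o n). now autorewrite with unpair in H. }
  exists (pPrec p q). intros o n. cbn [eval].
  change (fst (Cantor.of_nat n)) with (unl n).
  change (snd (Cantor.of_nat n)) with (unr n).
  generalize (unr n) as m. induction m as [ | m IHm ]; [ apply Hp | ].
  eexists. split; [ exact IHm | ]. cbn [nat_rect].
  match goal with |- eval _ _ ?k _ => specialize (Hq o k) end.
  now autorewrite with unpair in Hq.
Qed.

Lemma total_case e f g :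
  total e -> total f -> total (fun o n => g o (unl n) (unr n)) ->
  total (fun o n => match e o n with 0 => f o n | S k => g o n k end).
Proof.
  intros He Hf Hg.
  enough (total (fun o n =>
    nat_rect (fun _ => nat) (f o n) (fun m _ => g o n m) (e o n))) as [r H].
  { exists r. intros o n. specialize (H o n). now destruct (e o n). }
  apply (@total_rect _ (fun o n m _ => g o n m)); [ exact Hf | | exact He ].
  pose proof (total_comp Hg (total_pair (total_unl total_id)
    (total_unl (total_unr total_id)))) as [r H].
  exists r. intros o n. specialize (H o n). cbv beta in H.
  now autorewrite with unpair in H.
Qed.

Lemma total_add f g :
  total f -> total g -> total (fun o n => f o n + g o n).
Proof.
  intros Hf Hg.
  enough (total (fun o n =>
    nat_rect (fun _ => nat) (g o n) (fun _ c => S c) (f o n))) as H.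
  { destruct H as [r H]. exists r. intros o n. specialize (H o n).
    enough (nat_rect (fun _ => nat) (g o n) (fun _ c => S c) (f o n)
      = f o n + g o n) as <- by exact H.
    clear H. induction (f o n) as [ | k IHk ]; cbn; congruence. }
  apply (@total_rect _ (fun _ _ _ c => S c)); [ exact Hg | | exact Hf ].
  apply total_succ, total_unr, total_unr, total_id.
Qed.

Lemma total_sub f g :
  total f -> total g -> total (fun o n => f o n - g o n).
Proof.
  intros Hf Hg.
  enough (total (fun o n => nat_rect (fun _ => nat) (f o n)
    (fun _ c => match c with 0 => 0 | S k => k end) (g o n))) as H.
  { destruct H as [r H]. exists r. intros o n. specialize (H o n).
    enough (nat_rect (fun _ => nat) (f o n)
      (fun _ c => match c with 0 => 0 | S k => k end) (g o n)
      = f o n - g o n) as <- by exact H.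
    clear H. induction (g o n) as [ | k IHk ]; cbn [nat_rect]; [ lia | ].
    rewrite IHk. destruct (f o n - k) eqn:E; lia. }
  apply (@total_rect _
    (fun _ _ _ c => match c with 0 => 0 | S k => k end));
    [ exact Hf | | exact Hg ].
  apply (@total_case _ _ (fun _ _ k => k)).
  - apply total_unr, total_unr, total_id.
  - apply total_const.
  - apply total_unr, total_id.
Qed.

(** * Replacing the oracle by a computed sequence *)

(** [pPrec] and [pMin] append their own data to the right of the input ⟨c, n⟩; this brings the
    parameter [c] back to the front. *)
Definition reassoc : prog :=
  pPair (pComp pLeft pLeft) (pPair (pComp pRight pLeft) pRight).

(** [relativize p q] runs [p] on the second component of its input ⟨c, n⟩, and
    answers an oracle query [k] by running [q] on ⟨c, k⟩. *)
Fixpoint relativize (p q : prog) : prog :=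
  match p with
  | pZero => pZero
  | pSucc => pComp pSucc pRight
  | pLeft => pComp pLeft pRight
  | pRight => pComp pRight pRight
  | pOracle => q
  | pPair f g => pPair (relativize f q) (relativize g q)
  | pComp f g => pComp (relativize f q) (pPair pLeft (relativize g q))
  | pPrec f g =>
      pComp (pPrec (relativize f q) (pComp (relativize g q) reassoc))
        (pPair (pPair pLeft (pComp pLeft pRight)) (pComp pRight pRight))
  | pMin f => pMin (pComp (relativize f q) reassoc)
  end.

Lemma eval_reassoc o a b c : eval o reassoc ⟨⟨a, b⟩, c⟩ ⟨a, ⟨b, c⟩⟩.
Proof.
  assert (Hl : forall x y, x = fst (Cantor.of_nat ⟨x, y⟩))
    by (intros; now rewrite Cantor.cancel_of_to).
  assert (Hr : forall x y, y = snd (Cantor.of_nat ⟨x, y⟩))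
    by (intros; now rewrite Cantor.cancel_of_to).
  exists a, ⟨b, c⟩. split; [ exists ⟨a, b⟩; split; [ apply Hl | apply Hl ] | ].
  split; [ | reflexivity ].
  exists b, c. split; [ exists ⟨a, b⟩; split; [ apply Hl | apply Hr ] | ].
  split; [ apply Hr | reflexivity ].
Qed.

Lemma eval_relativize o c q x :
  (forall k, eval o q ⟨c, k⟩ (x k)) ->
  forall p n v, eval x p n v -> eval o (relativize p q) ⟨c, n⟩ v.
Proof.
  intros Hq.
  assert (Hl : forall a b, a = fst (Cantor.of_nat ⟨a, b⟩))
    by (intros; now rewrite Cantor.cancel_of_to).
  assert (Hr : forall a b, b = snd (Cantor.of_nat ⟨a, b⟩))
    by (intros; now rewrite Cantor.cancel_of_to).
  induction p as [ | | | | | f IHf g IHg | f IHf g IHg | f IHf g IHg | f IHf ];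
    intros n v; cbn [eval relativize].
  - trivial.
  - intros ->. exists n. split; [ apply Hr | reflexivity ].
  - intros ->. exists n. split; [ apply Hr | reflexivity ].
  - intros ->. exists n. split; [ apply Hr | reflexivity ].
  - intros ->. apply Hq.
  - intros (a & b & Ha & Hb & ->). exists a, b. auto.
  - intros (a & Ha & Hv). exists ⟨c, a⟩. split; [ | auto ].
    exists c, a. auto.
  - intros H.
    exists ⟨⟨c, unl n⟩, unr n⟩. split.
    { exists ⟨c, unl n⟩, (unr n). repeat split.
      - exists c, (unl n). repeat split; [ apply Hl | ].
        exists n. split; [ apply Hr | reflexivity ].
      - exists n. split; [ apply Hr | reflexivity ]. }
    rewrite <- Hl, <- Hr.
    change (fst (Cantor.of_nat n)) with (unl n) in H.
    change (snd (Cantor.of_nat n)) with (unr n) in H.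
    revert v H. generalize (unr n) as m.
    induction m as [ | m IHm ]; intros v; [ apply IHf | ].
    intros (w & Hw & Hv). exists w. split; [ exact (IHm _ Hw) | ].
    eexists. split; [ apply eval_reassoc | apply IHg, Hv ].
  - intros [Hv Hk]. split.
    + eexists. split; [ apply eval_reassoc | apply IHf, Hv ].
    + intros k Hlt. destruct (Hk k Hlt) as [w Hw]. exists w.
      eexists. split; [ apply eval_reassoc | apply IHf, Hw ].
Qed.

(** The sequence handed to [F] may depend on [n]: relativizing carries [n] along as the parameter of
    every query. *)
Lemma total_app (F : baire -> baire) (G : baire -> nat -> baire) h :
  total F -> total (fun o n => G o (unl n) (unr n)) -> total h ->
  total (fun o n => F (G o n) (h o n)).
Proof.
  intros [p Hp] [q Hq] Hh.
  enough (total (fun o n => F (G o (unl n)) (unr n))) as Hr.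
  { pose proof (total_comp Hr (total_pair total_id Hh)) as [r H].
    exists r. intros o n. specialize (H o n). cbv beta in H.
    now autorewrite with unpair in H. }
  exists (relativize p q). intros o n. rewrite <- (pair_surj n) at 1.
  apply eval_relativize with (x := G o (unl n)); [ | apply Hp ].
  intros k. specialize (Hq o ⟨unl n, k⟩). now autorewrite with unpair in Hq.
Qed.

Definition bundle (α β : baire) : baire :=
  fun m => match unl m with 0 => α (unr m) | S _ => β (unr m) end.

Lemma section_bundle_0 α β : section (bundle α β) 0 = α.
Proof.
  extensionality k. unfold section, bundle. now autorewrite with unpair.
Qed.

Lemma section_bundle_1 α β : section (bundle α β) 1 = β.
Proof.
  extensionality k. unfold section, bundle. now autorewrite with unpair.
Qed.

Lemma total_app2 F (G H : baire -> nat -> baire) h :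
  total2 F -> total (fun o n => G o (unl n) (unr n)) ->
  total (fun o n => H o (unl n) (unr n)) -> total h ->
  total (fun o n => F (G o n) (H o n) (h o n)).
Proof.
  intros HF HG HH Hh.
  destruct (@total_app (fun o => F (section o 0) (section o 1))
    (fun o n => bundle (G o n) (H o n)) h HF) as [r Hr]; [ | exact Hh | ].
  - unfold bundle.
    apply (@total_case (fun _ n => unl (unr n))
      (fun o n => G o (unl n) (unr (unr n)))
      (fun o n _ => H o (unl n) (unr (unr n)))).
    + apply total_unl, total_unr, total_id.
    + pose proof (total_comp HG (total_pair (total_unl total_id)
        (total_unr (total_unr total_id)))) as [r Hr].
      exists r. intros o n. specialize (Hr o n). cbv beta in Hr.
      now autorewrite with unpair in Hr.
    + pose proof (total_comp HH (total_pair (total_unl (total_unl total_id))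
        (total_unr (total_unr (total_unl total_id))))) as [r Hr].
      exists r. intros o n. specialize (Hr o n). cbv beta in Hr.
      now autorewrite with unpair in Hr.
  - exists r. intros o n. specialize (Hr o n). cbv beta in Hr.
    now rewrite section_bundle_0, section_bundle_1 in Hr.
Qed.

Definition unsection (f : nat -> baire) : baire := fun m => f (unl m) (unr m).

Lemma section_unsection f n : section (unsection f) n = f n.
Proof.
  extensionality k. unfold section, unsection. now autorewrite with unpair.
Qed.

Ltac total_step :=
  cbv beta;
  match goal with
  | H : total2 ?F |- total (fun o n => ?F _ _ _) =>
      simple apply (@total_app2 F); [ exact H | | | ]
  | H : total ?F |- total (fun o n => ?F _ _) =>
      simple apply (@total_app F); [ exact H | | ]
  | |- total (fun o n => n) => exact total_id
  | |- total (fun o n => match _ with 0 => _ | S _ => _ end) =>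
      simple apply total_case
  | |- total (fun o n => nat_rect _ _ _ _) => simple apply total_rect
  | |- total (fun o n => S _) => simple apply total_succ
  | |- total (fun o n => unl _) => simple apply total_unl
  | |- total (fun o n => unr _) => simple apply total_unr
  | |- total (fun o n => Cantor.to_nat (_, _)) => simple apply total_pair
  | |- total (fun o n => _ + _) => simple apply total_add
  | |- total (fun o n => _ - _) => simple apply total_sub
  | |- total (fun o n => o _) => simple apply total_oracle
  | |- total (fun o n => ?c) => exact (total_const c)
  end.

Ltac total :=
  unfold total2, unsection, bcons, bhd, btl, section;
  try match goal with |- total ?f => change (total (fun o n => f o n)) end;
  repeat total_step.

(** * Witnesses without leaves *)

Definition Wq (q : quant) (A : nat -> baire -> Prop) (α : baire) : Prop :=
  match q with
  | qEx => A (bhd α) (btl α)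
  | qAll => forall n, A n (section α n)
  | qExInf => forall n, n <= bhd (section α n) /\
      A (bhd (section α n)) (btl (section α n))
  | qAllInf => forall n, bhd α <= n -> A n (section (btl α) n)
  end.

(** The leaves of a witness only repeat the instance; here they are dropped.
    The instance [x] of the pattern [q :: Q] is a sequence of instances of [Q],
    even when [Q] is empty. The matrix is an arbitrary predicate [L] of the
    value of the instance, so as to cover a formula and its dual at once. *)
Fixpoint W (L : nat -> Prop) (Q : list quant) (x : baire) : baire -> Prop :=
  match Q with
  | [] => fun _ => L (x 0)
  | q :: Q' => Wq q (fun n => W L Q' (section x n))
  end.

(** The functorial action of a quantifier on witnesses: chosen values and bounds are kept, the
    branches are transformed. *)
Definition mapW (q : quant) (f : nat -> baire -> baire) (α : baire) : baire :=
  match q with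
  | qEx => bcons (bhd α) (f (bhd α) (btl α))
  | qAll => unsection (fun n => f n (section α n))
  | qExInf => unsection (fun n =>
      bcons (bhd (section α n)) (f (bhd (section α n)) (btl (section α n))))
  | qAllInf => bcons (bhd α) (unsection (fun n => f n (section (btl α) n)))
  end.

Lemma btl_bcons t α : btl (bcons t α) = α.
Proof. reflexivity. Qed.

Lemma Wq_mapW q (A B : nat -> baire -> Prop) f α :
  (forall n β, A n β -> B n (f n β)) -> Wq q A α -> Wq q B (mapW q f α).
Proof.
  intros H. destruct q; cbn [Wq mapW]; rewrite ?btl_bcons;
    [ | intros HA n .. ]; rewrite ?section_unsection, ?btl_bcons; auto.
  destruct (HA n). auto.
Qed.

Lemma total2_mapW q (F : baire -> baire -> baire) (H : nat -> baire -> baire) :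
  total2 F -> total (fun o n => H (unl n) o (unr n)) ->
  total2 (fun α x => mapW q (fun n β => F β (H n x)) α).
Proof.
  intros HF HH.
  (* The index of a branch may itself be computed from the witness, hence the arbitrary [e]. *)
  assert (HH' : forall e h : baire -> nat -> nat, total e -> total h ->
    total (fun o n => H (e o n) (section o 1) (h o n))).
  { intros e h He Hh.
    enough (total (fun o n => H (unl n) (section o 1) (unr n))) as Hr.
    { pose proof (total_comp Hr (total_pair He Hh)) as [r E].
      exists r. intros o n. specialize (E o n). cbv beta in E.
      now autorewrite with unpair in E. }
    refine (@total_app (fun o n => H (unl n) o (unr n))
      (fun o _ => section o 1) _ HH _ total_id). total. }
  destruct q; cbn [mapW]; total.
  all: apply HH'; total.
Qed.

(** * Translation between [W] and witnesses with leaves *)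

(** Unlike [code], this pairs the last entry with 0, so that stripping any quantifier, even the
    last, amounts to taking a [section]. *)
Fixpoint pcode (ns : list nat) : nat :=
  match ns with
  | [] => 0
  | n :: ns' => ⟨n, pcode ns'⟩
  end.

Lemma section_matches l ns (x y : baire) n :
  (forall ms, length ms = S l -> x (code (ns ++ ms)) = y (pcode ms)) ->
  forall ms, length ms = l ->
    x (code ((ns ++ [n]) ++ ms)) = section y n (pcode ms).
Proof.
  intros H ms Hms. rewrite <- app_assoc. apply (H (n :: ms)). cbn. now f_equal.
Qed.

(** Induction on the prefix; for all quantifiers but [qEx], countable choice collects the branch
    witnesses into one sequence. *)
Lemma truth_at_iff_W (L : nat -> Prop) Q :
  forall ns x y,
  (forall ms, length ms = length Q -> x (code (ns ++ ms)) = y (pcode ms)) ->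
  truth_at (fun ns x => L (x (code ns))) Q ns x <-> exists α, W L Q y α.
Proof.
  induction Q as [ | q Q IHQ ]; intros ns x y H; cbn [W].
  - specialize (H [] eq_refl). rewrite app_nil_r in H. cbn in *. rewrite H.
    split; [ now exists y | now intros [_ ?] ].
  - assert (IH := fun n => IHQ _ _ _ (section_matches _ _ _ n H)).
    destruct q; cbn [truth_at Wq].
    + split.
      * intros [n Hn]. apply IH in Hn as [α Hα]. now exists (bcons n α).
      * intros [α Hα]. exists (bhd α). apply IH. eauto.
    + split.
      * intros Hn.
        destruct (functional_choice _ (fun n => proj1 (IH n) (Hn n))) as [f Hf].
        exists (unsection f). intros n. rewrite section_unsection. apply Hf.
      * intros [α Hα] n. apply IH. eauto.
    + split.
      * intros Hn.
        destruct (functional_choice (fun m α => m <= bhd α /\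
          W L Q (section y (bhd α)) (btl α))) as [f Hf].
        { intros m. destruct (Hn m) as (n & Hle & Ht).
          apply IH in Ht as [α Hα]. now exists (bcons n α). }
        exists (unsection f). intros n. rewrite section_unsection. apply Hf.
      * intros [α Hα] m. destruct (Hα m). eexists. split; [ eassumption | ].
        apply IH. eauto.
    + split.
      * intros [m Hn].
        destruct (functional_choice (fun n α => m <= n ->
          W L Q (section y n) α)) as [f Hf].
        { intros n. destruct (le_lt_dec m n) as [Hle | Hlt].
          - destruct (proj1 (IH n) (Hn n Hle)) as [α Hα]. now exists α.
          (* Below the bound nothing is required; [y] is a default value. *)
          - exists y. intros. lia. }
        exists (bcons m (unsection f)). intros n. rewrite btl_bcons,
          section_unsection. apply Hf.
      * intros [α Hα]. exists (bhd α). intros n Hn. apply IH. eauto.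
Qed.

(** [W] reads [α] as [witness_at] does and merely ignores the leaves, so [α] stays unchanged. *)
Lemma W_of_witness_at (L : nat -> Prop) Q :
  forall ns x y α,
  (forall ms, length ms = length Q -> x (code (ns ++ ms)) = y (pcode ms)) ->
  witness_at (fun ns x => L (x (code ns))) Q ns x α -> W L Q y α.
Proof.
  induction Q as [ | q Q IHQ ]; intros ns x y α H; cbn [W].
  - specialize (H [] eq_refl). rewrite app_nil_r in H. cbn in *.
    rewrite <- H. now intros [_ ?].
  - assert (IH := fun n α => IHQ _ _ _ α (section_matches _ _ _ n H)).
    destruct q; cbn [witness_at Wq]; [ now auto .. | | now auto ].
    intros Hα n. destruct (Hα n). auto.
Qed.

(** [tuple] lists older values first, so the newest goes in behind the [l] earlier ones. *)
Fixpoint insert (l n : nat) (z : baire) : baire :=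
  match l with
  | 0 => bcons n z
  | S l' => bcons (z 0) (insert l' n (btl z))
  end.

Lemma insert_tuple n x ns :
  insert (length ns) n (tuple ns x) = tuple (ns ++ [n]) x.
Proof.
  induction ns as [ | m ns IHns ]; [ reflexivity | ].
  exact (f_equal (bcons m) IHns).
Qed.

Lemma total_insert l : total (fun o n => insert l (unl n) o (unr n)).
Proof.
  induction l as [ | l IHl ]; cbn [insert]; total.
  (* Named as a functional [F], the induction hypothesis can be applied by [total] to the shifted
     oracle. *)
  pose (F := fun o m => insert l (unl m) o (unr m)).
  change (total F) in IHl.
  enough (total (fun o n => F (fun k => o (S k)) ⟨unl (unl n), unr n⟩))
    as [r Hr] by
    (exists r; intros o n; specialize (Hr o n); unfold F in Hr;
     now autorewrite with unpair in Hr).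
  total.
Qed.

(** Restores the leaves, [z] being the leaf of the current branch and [l] the
    number of quantifiers stripped. *)
Fixpoint fill (Q : list quant) (l : nat) (z α : baire) : baire :=
  match Q with
  | [] => z
  | q :: Q' => mapW q (fun n β => fill Q' (S l) (insert l n z) β) α
  end.

Lemma witness_at_fill (L : nat -> Prop) Q :
  forall ns x y α,
  (forall ms, length ms = length Q -> x (code (ns ++ ms)) = y (pcode ms)) ->
  W L Q y α ->
  witness_at (fun ns x => L (x (code ns))) Q ns x
    (fill Q (length ns) (tuple ns x) α).
Proof.
  induction Q as [ | q Q IHQ ]; intros ns x y α H; cbn [W fill].
  - specialize (H [] eq_refl). rewrite app_nil_r in H. cbn in *.
    now rewrite H.
  - intros Hα.
    enough (Wq q
      (fun n => witness_at (fun ns x => L (x (code ns))) Q (ns ++ [n]) x)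
      (mapW q (fun n β => fill Q (S (length ns))
        (insert (length ns) n (tuple ns x)) β) α)) as Hw by now destruct q.
    revert Hα. apply Wq_mapW. intros n β Hβ.
    rewrite insert_tuple. replace (S (length ns)) with (length (ns ++ [n]))
      by (rewrite length_app; cbn; lia).
    apply IHQ with (2 := Hβ). now apply section_matches.
Qed.

Lemma total2_fill Q : forall l, total2 (fun α z => fill Q l z α).
Proof.
  induction Q as [ | q Q IHQ ]; intros l; cbn [fill]; [ total | ].
  apply (@total2_mapW q (fun β z => fill Q (S l) z β) (insert l));
    [ apply IHQ | apply total_insert ].
Qed.

(** * Reductions *)

(** Agreement of truth values follows from the two realizers, since by [truth_at_iff_W] truth is the
    existence of a witness. *)
Definition red (L : nat -> Prop) (η : baire -> baire) (Q P : list quant) :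
    Prop :=
  exists rm rp : baire -> baire -> baire, total2 rm /\ total2 rp /\
  forall x α,
    (W L Q x α -> W L P (η x) (rm α x)) /\
    (W L P (η x) α -> W L Q x (rp α x)).

Definition mred (Q P : list quant) : Prop :=
  exists η, total η /\ red (fun v => v = 0) η Q P.

(** Ranging over every [L] makes the notion symmetric under dualizing; [v = 0] gives the formulas
    and [v <> 0] their duals. *)
Definition dmred (Q P : list quant) : Prop :=
  exists η, total η /\
    (forall L, red L η Q P) /\
    (forall L, red L η (map qdual Q) (map qdual P)).

Lemma mred_of_dmred Q P : dmred Q P -> mred Q P.
Proof. intros (η & Hη & H & _). exists η. auto. Qed.

Lemma map_qdual_involutive Q : map qdual (map qdual Q) = Q.
Proof.
  induction Q as [ | q Q IHQ ]; [ reflexivity | ].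
  cbn. rewrite IHQ. now destruct q.
Qed.

Lemma dmred_dual Q P : dmred Q P -> dmred (map qdual Q) (map qdual P).
Proof.
  intros (η & Hη & H & Hd). exists η. now rewrite !map_qdual_involutive.
Qed.

Lemma red_trans L η θ Q P R :
  total η -> red L η Q P -> red L θ P R -> red L (fun x => θ (η x)) Q R.
Proof.
  intros Hη (rm & rp & Hrm & Hrp & H) (sm & sp & Hsm & Hsp & K).
  exists (fun α x => sm (rm α x) (η x)), (fun α x => rp (sp α (η x)) x).
  split; [ | split ].
  - total.
  - total.
  - intros x α. split; intros Hα.
    + apply K, H, Hα.
    + apply H, K, Hα.
Qed.

Lemma mred_trans Q P R : mred Q P -> mred P R -> mred Q R.
Proof.
  intros (η & Hη & H) (θ & Hθ & K). exists (fun x => θ (η x)).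
  split; [ total | eapply red_trans; eauto ].
Qed.

Lemma dmred_trans Q P R : dmred Q P -> dmred P R -> dmred Q R.
Proof.
  intros (η & Hη & H & H') (θ & Hθ & K & K'). exists (fun x => θ (η x)).
  split; [ total | split; intros L; eapply red_trans; eauto ].
Qed.

Lemma red_refl L Q : red L (fun x => x) Q Q.
Proof.
  exists (fun α _ => α), (fun α _ => α). split; [ total | split; [ total | ] ].
  tauto.
Qed.

Lemma mred_refl Q : mred Q Q.
Proof. exists (fun x => x). split; [ total | apply red_refl ]. Qed.

Lemma dmred_refl Q : dmred Q Q.
Proof.
  exists (fun x => x). split; [ total | split; intros; apply red_refl ].
Qed.

Definition branchwise (η : baire -> baire) (x : baire) : baire :=
  unsection (fun n => η (section x n)).

Lemma total_branchwise η : total η -> total (branchwise η).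
Proof. intros Hη. unfold branchwise. total. Qed.

Lemma red_cons L η q Q P : red L η Q P -> red L (branchwise η) (q :: Q) (q :: P).
Proof.
  intros (rm & rp & Hrm & Hrp & H).
  exists (fun α x => mapW q (fun n β => rm β (section x n)) α),
    (fun α x => mapW q (fun n β => rp β (section x n)) α).
  split; [ | split ].
  1, 2: apply (@total2_mapW q _ (fun n x => section x n)); [ assumption | total ].
  intros x α. cbn [W]. unfold branchwise.
  split; apply Wq_mapW; intros n β; rewrite section_unsection; apply H.
Qed.

Lemma mred_cons q Q P : mred Q P -> mred (q :: Q) (q :: P).
Proof.
  intros (η & Hη & H). exists (branchwise η).
  split; [ now apply total_branchwise | now apply red_cons ].
Qed.

Lemma dmred_cons q Q P : dmred Q P -> dmred (q :: Q) (q :: P).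
Proof.
  intros (η & Hη & H & H'). exists (branchwise η).
  split; [ now apply total_branchwise | ].
  split; intros; now apply red_cons.
Qed.

(** * Transfer to reducibility of the canonical formulas *)

Fixpoint code_of_pcode (l m : nat) : nat :=
  match l with
  | 0 => m
  | 1 => unl m
  | S l' => ⟨unl m, code_of_pcode l' (unr m)⟩
  end.

Fixpoint pcode_of_code (l m : nat) : nat :=
  match l with
  | 0 => m
  | 1 => ⟨m, 0⟩
  | S l' => ⟨unl m, pcode_of_code l' (unr m)⟩
  end.

Lemma code_of_pcode_spec ms : code_of_pcode (length ms) (pcode ms) = code ms.
Proof.
  induction ms as [ | m [ | m' ms ] IHms ]; [ reflexivity | .. ].
  - apply unl_pair.
  - change (⟨unl ⟨m, pcode (m' :: ms)⟩,
      code_of_pcode (length (m' :: ms)) (unr ⟨m, pcode (m' :: ms)⟩)⟩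
      = ⟨m, code (m' :: ms)⟩).
    now rewrite unl_pair, unr_pair, IHms.
Qed.

Lemma pcode_of_code_spec ms : pcode_of_code (length ms) (code ms) = pcode ms.
Proof.
  induction ms as [ | m [ | m' ms ] IHms ]; [ reflexivity | reflexivity | ].
  change (⟨unl ⟨m, code (m' :: ms)⟩,
    pcode_of_code (length (m' :: ms)) (unr ⟨m, code (m' :: ms)⟩)⟩
    = ⟨m, pcode (m' :: ms)⟩).
  now rewrite unl_pair, unr_pair, IHms.
Qed.

Lemma total_code_of_pcode l f :
  total f -> total (fun o n => code_of_pcode l (f o n)).
Proof.
  revert f. induction l as [ | [ | l ] IHl ]; intros f Hf; [ exact Hf | .. ].
  - now apply total_unl.
  - apply total_pair; [ now apply total_unl | now apply IHl, total_unr ].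
Qed.

Lemma total_pcode_of_code l f :
  total f -> total (fun o n => pcode_of_code l (f o n)).
Proof.
  revert f. induction l as [ | [ | l ] IHl ]; intros f Hf; [ exact Hf | .. ].
  - apply total_pair; [ exact Hf | apply total_const ].
  - apply total_pair; [ now apply total_unl | now apply IHl, total_unr ].
Qed.

Lemma computes_total f : total f -> exists p, forall x, computes p x (f x).
Proof. intros [p H]. exists p. intros x n. apply H. Qed.

Lemma computes_total2 F :
  total2 F -> exists p, forall α x, computes p (join α x) (F α x).
Proof.
  intros HF.
  assert (HF' : total (fun o => F (fun k => o (k + k)) (fun k => o (S (k + k)))))
    by total.
  destruct HF' as [p Hp]. exists p. intros α x n. specialize (Hp (join α x) n).
  assert ((fun k => join α x (k + k)) = α) as Hα.
  { extensionality k. unfold join. replace (k + k) with (2 * k) by lia.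
    now rewrite Nat.even_even, Nat.div2_double. }
  assert ((fun k => join α x (S (k + k))) = x) as Hx.
  { extensionality k. unfold join. replace (S (k + k)) with (S (2 * k)) by lia.
    rewrite Nat.div2_succ_double. replace (S (2 * k)) with (2 * k + 1) by lia.
    now rewrite Nat.even_odd. }
  now rewrite Hα, Hx in Hp.
Qed.

(** Canonical instances are indexed by [code], those of [W] by [pcode]; [η] is conjugated
    accordingly. *)
Definition recode (η : baire -> baire) (Q P : list quant) (x : baire) : baire :=
  fun m => η (fun k => x (code_of_pcode (length Q) k))
    (pcode_of_code (length P) m).

Lemma total_recode η Q P : total η -> total (recode η Q P).
Proof.
  intros Hη. unfold recode.
  apply (@total_app η (fun x _ k => x (code_of_pcode (length Q) k))
    (fun _ m => pcode_of_code (length P) m)); [ exact Hη | | ].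
  - apply total_oracle, total_code_of_pcode. total.
  - apply total_pcode_of_code. total.
Qed.

Lemma reduces_via_red (L : nat -> Prop) η Q P p :
  red L η Q P -> total η -> (forall x, computes p x (recode η Q P x)) ->
  reduces_via p (Formula Q (fun ns x => L (x (code ns))))
    (Formula P (fun ns x => L (x (code ns)))).
Proof.
  intros (rm & rp & Hrm & Hrp & H) Hη Hp.
  pose (flat := fun x k => x (code_of_pcode (length Q) k) : nat).
  assert (Hflat : total flat)
    by (apply total_oracle, total_code_of_pcode, total_id).
  pose proof (total_recode Q P Hη) as Hrec.
  pose proof (total2_fill P 0) as HfP. pose proof (total2_fill Q 0) as HfQ.
  set (fillP := fun α z => fill P 0 z α) in HfP.
  set (fillQ := fun α z => fill Q 0 z α) in HfQ.
  set (η' := recode η Q P) in *.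
  (* The leaves of the resulting witness are restored from the instance it belongs to: [η' x] in one
     direction, [x] in the other. *)
  assert (Hm : total2 (fun α x => fillP (rm α (flat x)) (η' x))) by total.
  assert (Hm' : total2 (fun α x => fillQ (rp α (flat x)) x)) by total.
  destruct (computes_total2 Hm) as [q Hq], (computes_total2 Hm') as [r Hr].
  exists q, r. intros x _. exists (η' x). split; [ apply Hp | ].
  assert (HQ : forall ms, length ms = length Q ->
    x (code ([] ++ ms)) = flat x (pcode ms)).
  { intros ms Hms. unfold flat. rewrite <- Hms. cbn [app].
    now rewrite code_of_pcode_spec. }
  assert (HP : forall ms, length ms = length P ->
    η' x (code ([] ++ ms)) = η (flat x) (pcode ms)).
  { intros ms Hms. unfold η', recode. rewrite <- Hms. cbn [app].
    now rewrite pcode_of_code_spec. }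
  split; [ | split ].
  - unfold truth. cbn [matrix prefix].
    rewrite (@truth_at_iff_W L _ _ _ _ HQ), (@truth_at_iff_W L _ _ _ _ HP).
    split; intros [α Hα]; eexists; apply H, Hα.
  - intros α Hα. eexists. split; [ apply Hq | ].
    apply (@W_of_witness_at L _ _ _ _ _ HQ) in Hα.
    apply (@witness_at_fill L _ _ _ _ _ HP), H, Hα.
  - intros α Hα. eexists. split; [ apply Hr | ].
    apply (@W_of_witness_at L _ _ _ _ _ HP) in Hα.
    apply (@witness_at_fill L _ _ _ _ _ HQ), H, Hα.
Qed.

Lemma m_le_of_mred Q P : mred Q P -> m_le (canonical Q) (canonical P).
Proof.
  intros (η & Hη & H).
  destruct (computes_total (total_recode Q P Hη)) as [p Hp].
  exists p. exact (@reduces_via_red (fun v => v = 0) _ _ _ _ H Hη Hp).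
Qed.

Lemma dm_le_of_dmred Q P : dmred Q P -> dm_le (canonical Q) (canonical P).
Proof.
  intros (η & Hη & H & H').
  destruct (computes_total (total_recode Q P Hη)) as [p Hp].
  exists p. split; [ exact (@reduces_via_red (fun v => v = 0) _ _ _ _ (H _) Hη Hp) | ].
  apply (@reduces_via_red (fun v => v <> 0) _ _ _ p (H' _) Hη).
  (* Dualizing preserves the length of a pattern, so [p] serves the duals too. *)
  unfold recode in *. now rewrite !length_map.
Qed.

(** * Reductions valid for the duals *)

(** Two variables are coded as a pair; on the dual side, sections are reindexed along the
    pairing. *)
Lemma dmred_ex_ex R : dmred (qEx :: qEx :: R) (qEx :: R).
Proof.
  exists (fun x => unsection (fun p => section (section x (unl p)) (unr p))).
  split; [ total | split; intros L ].
  - exists (fun α _ => bcons ⟨α 0, α 1⟩ (fun k => α (S (S k)))),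
      (fun α _ => bcons (unl (bhd α)) (bcons (unr (bhd α)) (btl α))).
    split; [ total | split; [ total | ] ].
    intros x α. cbn [W Wq]. rewrite !section_unsection. cbn [bhd bcons].
    rewrite unl_pair, unr_pair. split; intros H; exact H.
  - exists (fun α _ => unsection (fun p => section (section α (unl p)) (unr p))),
      (fun α _ => unsection (fun n => unsection (fun m => section α ⟨n, m⟩))).
    split; [ total | split; [ total | ] ].
    intros x α. cbn [map qdual W Wq]. split.
    + intros H p. rewrite !section_unsection. apply H.
    + intros H n m. specialize (H ⟨n, m⟩). rewrite !section_unsection in *.
      now rewrite unl_pair, unr_pair in H.
Qed.

(** A dummy variable is added; the value 0 stands for any value. *)
Lemma dmred_ex R : dmred R (qEx :: R).
Proof.
  exists (fun x => unsection (fun _ => x)). split; [ total | split; intros L ].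
  - exists (fun α _ => bcons 0 α), (fun α _ => btl α).
    split; [ total | split; [ total | ] ].
    intros x α. cbn [W Wq]. now rewrite !section_unsection.
  - exists (fun α _ => unsection (fun _ => α)), (fun α _ => section α 0).
    split; [ total | split; [ total | ] ].
    intros x α. cbn [map qdual W Wq]. split.
    + intros H n. now rewrite !section_unsection.
    + intros H. specialize (H 0). now rewrite section_unsection in H.
Qed.

Lemma le_unr n m : m <= ⟨n, m⟩.
Proof. pose proof (Cantor.to_nat_non_decreasing n m). lia. Qed.

Lemma le_unl n m : n <= ⟨n, m⟩.
Proof. pose proof (Cantor.to_nat_non_decreasing n m). lia. Qed.

(** Padding the bound variable makes every value recur infinitely often. *)
Lemma dmred_ex_exinf R : dmred (qEx :: R) (qExInf :: R).
Proof.
  exists (fun x => unsection (fun p => section x (unl p))).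
  split; [ total | split; intros L ].
  - exists (fun α _ => unsection (fun n => bcons ⟨bhd α, n⟩ (btl α))),
      (fun α _ => bcons (unl (bhd (section α 0))) (btl (section α 0))).
    split; [ total | split; [ total | ] ].
    intros x α. cbn [W Wq]. split.
    + intros H n. rewrite !section_unsection. split; [ apply le_unr | ].
      cbn [bhd bcons]. now rewrite unl_pair.
    + intros H. destruct (H 0) as [_ H0]. now rewrite section_unsection in H0.
  - exists (fun α _ => bcons 0 (unsection (fun p => section α (unl p)))),
      (* The index ⟨m, bhd α⟩ lies past the bound of [α] and still stands for [m]. *)
      (fun α _ => unsection (fun m => section (btl α) ⟨m, bhd α⟩)).
    split; [ total | split; [ total | ] ].
    intros x α. cbn [map qdual W Wq]. split.
    + intros H p _. rewrite !btl_bcons, !section_unsection. apply H.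
    + intros H m. specialize (H ⟨m, bhd α⟩ (le_unr _ _)).
      rewrite !section_unsection in *. now rewrite unl_pair in H.
Qed.

(** The outer variable absorbs the bound: it becomes a pair ⟨n, t⟩, and the inner one the offset
    from [t]. Dually, the bound of [qAllInf] joins the outer existential value. *)
Lemma dmred_all_exinf R : dmred (qAll :: qExInf :: R) (qAll :: qEx :: R).
Proof.
  exists (fun x => unsection (fun p => unsection (fun m =>
    section (section x (unl p)) (unr p + m)))).
  split; [ total | split; intros L ].
  - exists (fun α _ => unsection (fun p =>
      let β := section (section α (unl p)) (unr p) in
      bcons (bhd β - unr p) (btl β))),
      (fun α _ => unsection (fun n => unsection (fun t =>
        bcons (t + bhd (section α ⟨n, t⟩)) (btl (section α ⟨n, t⟩))))).
    split; [ total | split; [ total | ] ].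
    intros x α. cbn [W Wq]. split.
    + intros H p. destruct (H (unl p) (unr p)) as [Hle Hw].
      rewrite !section_unsection, btl_bcons. cbn [bhd bcons].
      (* By [Hle] the chosen value is at least [unr p], so truncated subtraction loses nothing. *)
      now replace (unr p + _) with (bhd (section (section α (unl p)) (unr p)))
        by (unfold bhd in *; lia).
    + intros H n t. specialize (H ⟨n, t⟩).
      rewrite !section_unsection, ?btl_bcons in *.
      rewrite unl_pair, unr_pair in H. split; [ cbn; lia | exact H ].
  - exists (fun α _ => bcons ⟨α 0, α 1⟩ (unsection (fun m =>
        section (fun k => α (S (S k))) (α 1 + m)))),
      (fun α _ => bcons (unl (α 0)) (bcons (unr (α 0))
        (unsection (fun m => section (btl α) (m - unr (α 0)))))).
    split; [ total | split; [ total | ] ].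
    intros x α. cbn [map qdual W Wq]. rewrite !section_unsection, !btl_bcons.
    cbn [bhd bcons]. split.
    + intros H m. rewrite !section_unsection, unl_pair, unr_pair.
      apply H. unfold bhd, btl. lia.
    + intros H m Hm. specialize (H (m - unr (bhd α))).
      rewrite !section_unsection in *.
      now replace (unr (bhd α) + (m - unr (bhd α))) with m in H
        by (unfold bhd; lia).
Qed.

(** * Reductions not valid for the duals *)

Lemma mred_exinf_all_ex R : mred (qExInf :: R) (qAll :: qEx :: R).
Proof.
  exists (fun x => unsection (fun n => unsection (fun m => section x (n + m)))).
  split; [ total | ].
  exists (fun α _ => unsection (fun n =>
      bcons (bhd (section α n) - n) (btl (section α n)))),
    (fun α _ => unsection (fun n =>
      bcons (n + bhd (section α n)) (btl (section α n)))).
  split; [ total | split; [ total | ] ].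
  intros x α. cbn [W Wq]. split.
  - intros H n. destruct (H n) as [Hle Hw].
    rewrite !section_unsection, btl_bcons. cbn [bhd bcons].
    now replace (n + _) with (bhd (section α n)) by (unfold bhd in *; lia).
  - intros H n. specialize (H n). rewrite !section_unsection, ?btl_bcons in *.
    cbn [bhd bcons]. split; [ lia | exact H ].
Qed.

(** * Finite lists of choices: ∀∃∀ ≤ ∃∞∃∀ *)

Definition stack (f : nat -> nat) (N : nat) : nat :=
  nat_rect (fun _ => nat) ⟨f 0, 0⟩ (fun m c => ⟨f (S m), c⟩) N.

(** [stack] keeps its latest value outermost, so the value at [i] lies [N - i] pairings deep. *)
Definition entry (N M i : nat) : nat :=
  unl (nat_rect (fun _ => nat) M (fun _ c => unr c) (N - i)).

Lemma entry_stack f N i : i <= N -> entry N (stack f N) i = f i.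
Proof.
  intros Hi. unfold entry. replace i with (N - (N - i)) at 2 by lia.
  assert (Hd : N - i <= N) by lia. revert Hd. generalize (N - i) as d.
  intros d Hd.
  assert (nat_rect (fun _ => nat) (stack f N) (fun _ c => unr c) d
    = stack f (N - d)) as ->.
  { induction d as [ | d IHd ]; cbn [nat_rect]; [ now rewrite Nat.sub_0_r | ].
    rewrite IHd by lia. replace (N - d) with (S (N - S d)) by lia.
    apply unr_pair. }
  destruct (N - d); apply unl_pair.
Qed.

(** Asking at stage [N] for the choices at all [i <= N] makes the stages
    monotone, so that infinitely many of them give all of them. *)
Lemma mred_all_ex_all :
  mred [qAll; qEx; qAll] [qExInf; qEx; qAll].
Proof.
  exists (fun x => unsection (fun N => unsection (fun M =>
    unsection (fun q j =>
      match unl q - N with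
      | 0 => section (section (section x (unl q)) (entry N M (unl q)))
          (unr q) j
      (* Beyond stage [N] nothing is asked: the value 0 makes the matrix true. *)
      | S _ => 0
      end)))).
  split; [ unfold entry; total | ].
  (* Below the last ∀ no part of a witness is read, so [α] only fills the place, here and in the
     other realizer. *)
  exists (fun α _ => unsection (fun N => bcons N
      (bcons (stack (fun i => bhd (section α i)) N) α))),
    (fun α _ => unsection (fun n =>
      bcons (entry (bhd (section α n)) (bhd (btl (section α n))) n) α)).
  split; [ unfold stack; total | split; [ unfold entry; total | ] ].
  intros x α. cbn [W Wq]. split.
  - intros H N. rewrite !section_unsection, !btl_bcons. cbn [bhd bcons].
    split; [ lia | ]. intros q. rewrite !section_unsection.
    destruct (unl q - N) eqn:E; [ | reflexivity ].
    rewrite entry_stack by lia. apply H.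
  - intros H n k. rewrite section_unsection. cbn [bhd bcons].
    destruct (H n) as [Hle Hw]. specialize (Hw ⟨n, k⟩).
    rewrite !section_unsection, unl_pair, unr_pair in Hw.
    now replace (n - bhd (section α n)) with 0 in Hw by lia.
Qed.

(** Returns some zero of [f] up to [b], and [0] if there is none. *)
Definition search (f : nat -> nat) (b : nat) : nat :=
  nat_rect (fun _ => nat) 0
    (fun j r => match f (S j) with 0 => S j | S _ => r end) b.

Lemma search_spec f b : (exists j, j <= b /\ f j = 0) -> f (search f b) = 0.
Proof.
  induction b as [ | b IHb ]; intros (j & Hj & Hf).
  - now replace j with 0 in Hf by lia.
  - cbn [search nat_rect]. destruct (f (S b)) eqn:E; [ exact E | ].
    apply IHb. exists j. split; [ | exact Hf ].
    destruct (Nat.eq_dec j (S b)) as [-> | ]; [ congruence | lia ].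
Qed.

(** An increasing sequence of values provided by the witness [α] of [∃∞]. *)
Definition climb (α : baire) (i : nat) : nat :=
  nat_rect (fun _ => nat) (bhd (section α 0))
    (fun _ p => bhd (section α (S p))) i.

Lemma climb_spec (A : nat -> Prop) α :
  (forall n, n <= bhd (section α n) /\ A (bhd (section α n))) ->
  forall i, A (climb α i) /\ climb α i < climb α (S i).
Proof.
  intros H i. split; [ destruct i; apply H | ].
  destruct (H (S (climb α i))) as [Hle _]. exact Hle.
Qed.

(** * Sequential search: ∀∃ ≤ ∃∞ *)

(** State ⟨n, k⟩ after [t] tests: every value below [n] has its witness, and [k] is the next
    candidate for [n]. *)
Definition runstate (x : baire) (t : nat) : nat :=
  nat_rect (fun _ => nat) ⟨0, 0⟩
    (fun _ s => match x ⟨unl s, ⟨unr s, 0⟩⟩ with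
       | 0 => ⟨S (unl s), 0⟩
       | S _ => ⟨unl s, S (unr s)⟩
       end) t.

Definition answer (x : baire) (t : nat) : nat :=
  x ⟨unl (runstate x t), ⟨unr (runstate x t), 0⟩⟩.

Lemma runstate_hit x t : answer x t = 0 ->
  runstate x (S t) = ⟨S (unl (runstate x t)), 0⟩.
Proof.
  unfold answer. intros H.
  change (runstate x (S t)) with
    (match answer x t with
     | 0 => ⟨S (unl (runstate x t)), 0⟩
     | S _ => ⟨unl (runstate x t), S (unr (runstate x t))⟩
     end).
  unfold answer. now rewrite H.
Qed.

Lemma runstate_miss x t : answer x t <> 0 ->
  runstate x (S t) = ⟨unl (runstate x t), S (unr (runstate x t))⟩.
Proof.
  unfold answer. intros H.
  change (runstate x (S t)) with
    (match answer x t with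
     | 0 => ⟨S (unl (runstate x t)), 0⟩
     | S _ => ⟨unl (runstate x t), S (unr (runstate x t))⟩
     end).
  unfold answer. now destruct (x _).
Qed.

(** The bounds by [t] later confine the search for witnesses; the negative clause puts any witness
    for the current value at or beyond the current candidate. *)
Lemma runstate_invariant x t :
  unr (runstate x t) <= t /\
  (forall k, k < unr (runstate x t) ->
     x ⟨unl (runstate x t), ⟨k, 0⟩⟩ <> 0) /\
  (forall n, n < unl (runstate x t) ->
     exists k, k <= t /\ x ⟨n, ⟨k, 0⟩⟩ = 0).
Proof.
  induction t as [ | t (Hk & Hneg & Hpos) ].
  { cbn [runstate nat_rect]. rewrite unl_pair, unr_pair.
    repeat split; intros; lia. }
  destruct (Nat.eq_dec (answer x t) 0) as [E | E].
  - rewrite (runstate_hit _ _ E), unl_pair, unr_pair.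
    split; [ lia | split; [ lia | ] ]. intros n Hn.
    destruct (Nat.eq_dec n (unl (runstate x t))) as [-> | Hne].
    + exists (unr (runstate x t)). split; [ lia | exact E ].
    + destruct (Hpos n) as (k & Hkt & Hx); [ lia | ].
      exists k. split; [ lia | exact Hx ].
  - rewrite (runstate_miss _ _ E), unl_pair, unr_pair.
    split; [ lia | split ].
    + intros k Hkl. destruct (Nat.eq_dec k (unr (runstate x t))) as [-> | Hne];
        [ exact E | apply Hneg; lia ].
    + intros n Hn. destruct (Hpos n Hn) as (k & Hkt & Hx).
      exists k. split; [ lia | exact Hx ].
Qed.

Lemma unl_runstate_monotone x s t :
  s <= t -> unl (runstate x s) <= unl (runstate x t).
Proof.
  induction 1 as [ | t Hst IH ]; [ lia | ].
  destruct (Nat.eq_dec (answer x t) 0) as [E | E].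
  - rewrite (runstate_hit _ _ E), unl_pair. lia.
  - rewrite (runstate_miss _ _ E), unl_pair. lia.
Qed.

(** Each failed test raises the candidate by one, so it reaches [k] after at most [d] of them. *)
Lemma runstate_hits x k d : forall t,
  unr (runstate x t) + d = k -> x ⟨unl (runstate x t), ⟨k, 0⟩⟩ = 0 ->
  exists j, j <= d /\ answer x (t + j) = 0.
Proof.
  induction d as [ | d IHd ]; intros t Hd Hx;
    (destruct (Nat.eq_dec (answer x t) 0) as [E | E];
     [ exists 0; split; [ lia | now rewrite Nat.add_0_r ] | ]).
  - exfalso. apply E. unfold answer.
    now replace (unr (runstate x t)) with k by lia.
  - destruct (IHd (S t)) as (j & Hj & Ha).
    + rewrite (runstate_miss _ _ E), unr_pair. lia.
    + now rewrite (runstate_miss _ _ E), unl_pair.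
    + exists (S j). split; [ lia | ]. now rewrite Nat.add_succ_r.
Qed.

(** The infinitely many events are the successes of the sequential search for
    a witness for [n = 0], then for [n = 1], and so on. *)
Lemma mred_all_ex : mred [qAll; qEx] [qExInf].
Proof.
  exists (fun x => unsection (fun t _ => answer x t)).
  split; [ unfold answer, runstate; total | ].
  (* At stage [n], the witness [α] gives for the value under search bounds the wait for the next
     success. *)
  exists (fun α x => unsection (fun n _ => n + search (fun j => answer x (n + j))
      (bhd (section α (unl (runstate x n)))))),
    (fun α x => unsection (fun n _ =>
      search (fun k => x ⟨n, ⟨k, 0⟩⟩) (climb α n))).
  split; [ unfold search, answer, runstate; total | ].
  split; [ unfold search, climb; total | ].
  intros x α. cbn [W Wq]. split.
  - intros H t. rewrite !section_unsection. split; [ apply Nat.le_add_r | ].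
    cbn [bhd]. apply (search_spec (fun j => answer x (t + j))).
    destruct (runstate_invariant x t) as (_ & Hneg & _).
    specialize (H (unl (runstate x t))).
    set (k := bhd (section α (unl (runstate x t)))) in *.
    assert (unr (runstate x t) <= k).
    { destruct (le_lt_dec (unr (runstate x t)) k) as [Hle | Hlt]; [ exact Hle | ].
      now destruct (Hneg k Hlt). }
    destruct (@runstate_hits x k (k - unr (runstate x t)) t) as (j & Hj & Ha);
      [ lia | exact H | ].
    exists j. split; [ lia | exact Ha ].
  - intros H n. rewrite section_unsection. cbn [bhd].
    apply (search_spec (fun k => x ⟨n, ⟨k, 0⟩⟩)).
    assert (Hc := climb_spec (fun t => answer x t = 0) α).
    (* The stages [climb α i] are successes in strictly increasing order, and each completes one
       more value. *)
    assert (Hn : n <= unl (runstate x (climb α n))).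
    { clear -H Hc. induction n as [ | n IHn ]; [ lia | ].
      destruct Hc with (i := n) as [Ha Hlt].
      { intros m. specialize (H m). now rewrite section_unsection in H. }
      apply unl_runstate_monotone with (x := x) in Hlt.
      rewrite (runstate_hit _ _ Ha), unl_pair in Hlt. lia. }
    destruct Hc with (i := n) as [Ha _].
    { intros m. specialize (H m). now rewrite section_unsection in H. }
    destruct (runstate_invariant x (climb α n)) as (Hle & _ & Hpos).
    (* Either [n] is the current value, settled by this very success, or it was completed
       earlier. *)
    destruct (Nat.eq_dec n (unl (runstate x (climb α n)))) as [E | E].
    + exists (unr (runstate x (climb α n))). split; [ exact Hle | ].
      rewrite E at 1. exact Ha.
    + apply Hpos. lia.
Qed.

(** * Least bounds: ∃∞∀∞ ≤ ∃∞∀ *)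

(** One more than the last nonzero position below [t], or 0 if there is none; when [a] vanishes from
    [t] on, this is its least bound. *)
Definition tail (a : nat -> nat) (t : nat) : nat :=
  nat_rect (fun _ => nat) 0
    (fun s r => match a s with 0 => r | S _ => S s end) t.

Lemma tail_zero a t m : tail a t <= m -> m < t -> a m = 0.
Proof.
  induction t as [ | t IHt ]; cbn [tail nat_rect]; [ lia | ].
  destruct (a t) eqn:E; intros Hle Hlt; [ | lia ].
  destruct (Nat.eq_dec m t) as [-> | ]; [ exact E | apply IHt; [ exact Hle | lia ] ].
Qed.

Lemma tail_pred a t s : tail a t = S s -> a s <> 0.
Proof.
  induction t as [ | t IHt ]; cbn [tail nat_rect]; [ discriminate | ].
  destruct (a t) eqn:E; [ exact IHt | ]. intros [= <-]. congruence.
Qed.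

(** Pigeonhole: [S N] distinct values cannot all lie below [N]. *)
Lemma injective_values_unbounded (f p : nat -> nat) N :
  (forall i j, f (p i) = f (p j) -> i = j) -> exists i, i <= N /\ N <= f (p i).
Proof.
  intros Hinj.
  destruct (Exists_dec (fun i => N <= f (p i)) (seq 0 (S N))
    (fun i => le_dec N (f (p i)))) as [H | H].
  - apply Exists_exists in H as (i & Hi%in_seq & Hle).
    exists i. split; [ lia | exact Hle ].
  - exfalso.
    assert (Hlen : length (map (fun i => f (p i)) (seq 0 (S N)))
      <= length (seq 0 N)).
    { apply NoDup_incl_length.
      - apply NoDup_map_NoDup_ForallPairs; [ | apply seq_NoDup ].
        intros i j _ _. apply Hinj.
      - intros k (i & <- & Hi)%in_map_iff. apply in_seq.
        destruct (le_lt_dec N (f (p i))) as [Hle | Hlt]; [ | lia ].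
        exfalso. apply H, Exists_exists. eauto. }
    rewrite length_map, !length_seq in Hlen. lia.
Qed.

(** The least [t] beyond which the matrix holds is unique for each [n], so
    infinitely many such pairs ⟨n, t⟩ have unbounded first components; it is
    computed from any other [t]. *)
Lemma mred_exinf_allinf : mred [qExInf; qAllInf] [qExInf; qAll].
Proof.
  exists (fun x => unsection (fun p => unsection (fun m _ =>
    match unr p with
    | 0 => x ⟨unl p, ⟨m, 0⟩⟩
    | S s =>
        match x ⟨unl p, ⟨s, 0⟩⟩ with
        (* If the matrix already holds at [s], then [S s] is not the least bound, and the value 1
           rejects the pair. *)
        | 0 => 1
        | S _ => x ⟨unl p, ⟨S s + m, 0⟩⟩
        end
    end))).
  split; [ total | ].
  (* Among the first [S n] pairs of [climb], some first component is at least [n]; the truncated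
     difference turns this into a zero for [search]. *)
  pose (pick := fun α n =>
    climb α (search (fun i => n - unl (climb α i)) n) : nat).
  exists (fun α x => unsection (fun N =>
      let n := bhd (section α N) in
      bcons ⟨n, tail (fun m => x ⟨n, ⟨m, 0⟩⟩) (bhd (btl (section α N)))⟩ α)),
    (fun α _ => unsection (fun n =>
      bcons (unl (pick α n)) (bcons (unr (pick α n)) α))).
  split; [ unfold tail; total | ].
  split; [ unfold pick, search, climb; total | ].
  intros x α. cbn [W Wq]. split.
  - intros H N. destruct (H N) as [Hle Hw].
    rewrite section_unsection. cbv zeta. cbn [bhd bcons].
    set (n := bhd (section α N)) in *.
    set (t := bhd (btl (section α N))) in *.
    split; [ eapply Nat.le_trans; [ exact Hle | apply le_unl ] | ].
    intros m. rewrite !section_unsection, unl_pair, unr_pair.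
    assert (Hz : forall k, tail (fun m => x ⟨n, ⟨m, 0⟩⟩) t <= k ->
      x ⟨n, ⟨k, 0⟩⟩ = 0).
    { intros k Hk. destruct (le_lt_dec t k) as [Htk | Hkt]; [ now apply Hw | ].
      exact (tail_zero _ Hk Hkt). }
    destruct (tail _ t) as [ | s ] eqn:E; [ apply Hz; lia | ].
    apply (tail_pred (fun m => x ⟨n, ⟨m, 0⟩⟩)) in E.
    destruct (x ⟨n, ⟨s, 0⟩⟩); [ easy | ]. apply Hz. lia.
  - intros H.
    pose (good := fun p => (forall m, unr p <= m -> x ⟨unl p, ⟨m, 0⟩⟩ = 0) /\
      forall s, unr p = S s -> x ⟨unl p, ⟨s, 0⟩⟩ <> 0).
    assert (Hc : forall i, good (climb α i) /\ climb α i < climb α (S i)).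
    { apply climb_spec. intros N. destruct (H N) as [Hle Hw].
      split; [ exact Hle | ]. revert Hw. set (p := bhd (section α N)).
      rewrite section_unsection. intros Hu.
      assert (Hw := fun m => eq_trans
        (eq_sym (f_equal (fun f => f 0) (section_unsection _ m))) (Hu m)).
      cbv beta in Hw. clear Hu. unfold good.
      destruct (unr p) as [ | s ].
      - split; [ auto | discriminate ].
      - assert (Hs : x ⟨unl p, ⟨s, 0⟩⟩ <> 0)
          by (intros E; specialize (Hw 0); now rewrite E in Hw).
        split; [ | now intros ? [= <-] ]. intros m Hm.
        specialize (Hw (m - S s)). destruct (x ⟨unl p, ⟨s, 0⟩⟩); [ easy | ].
        now replace (S s + (m - S s)) with m in Hw by lia. }
    assert (Hmono : forall i j, i < j -> climb α i < climb α j).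
    { intros i j Hij. induction Hij as [ | j Hij IH ]; [ apply Hc | ].
      destruct (Hc j). lia. }
    (* Minimality of the bound makes a good pair depend on its first component alone, so distinct
       pairs have distinct first components. *)
    assert (Huniq : forall p q, good p -> good q -> unl p = unl q ->
      unr p <= unr q).
    { intros p q [_ Hp] [Hq _] E.
      destruct (unr p) as [ | s ]; [ lia | ].
      destruct (le_lt_dec (S s) (unr q)) as [Hle | Hlt]; [ exact Hle | ].
      destruct (Hp s eq_refl). rewrite E. apply Hq. lia. }
    assert (Hpick : forall n, n <= unl (pick α n)).
    { intros n. enough (n - unl (pick α n) = 0) by lia.
      apply (search_spec (fun i => n - unl (climb α i))).
      destruct (@injective_values_unbounded unl (climb α) n) as (i & Hi & Hn).
      - intros i j E.
        assert (unr (climb α i) = unr (climb α j)).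
        { apply Nat.le_antisymm; apply Huniq; auto; apply Hc. }
        assert (climb α i = climb α j)
          by (rewrite <- (pair_surj (climb α i)), <- (pair_surj (climb α j));
              congruence).
        destruct (Nat.lt_trichotomy i j) as [Hij | [Hij | Hij]];
          [ apply Hmono in Hij; lia | exact Hij | apply Hmono in Hij; lia ].
      - exists i. split; [ exact Hi | lia ]. }
    intros n. rewrite section_unsection, !btl_bcons. cbn [bhd bcons].
    split; [ apply Hpick | ]. intros m Hm. apply Hc, Hm.
Qed.

(** * Normal forms *)

Definition dmeq (Q P : list quant) : Prop := dmred Q P /\ dmred P Q.
Definition meq (Q P : list quant) : Prop := mred Q P /\ mred P Q.

#[local] Instance dmeq_equivalence : Equivalence dmeq.
Proof.
  split.
  - intros Q. split; apply dmred_refl.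
  - intros Q P []. now split.
  - intros Q P R [] []. split; eapply dmred_trans; eauto.
Qed.

#[local] Instance dmeq_cons : Proper (eq ==> dmeq ==> dmeq) cons.
Proof. intros q _ <- Q P []. split; now apply dmred_cons. Qed.

#[local] Instance meq_equivalence : Equivalence meq.
Proof.
  split.
  - intros Q. split; apply mred_refl.
  - intros Q P []. now split.
  - intros Q P R [] []. split; eapply mred_trans; eauto.
Qed.

#[local] Instance meq_cons : Proper (eq ==> meq ==> meq) cons.
Proof. intros q _ <- Q P []. split; now apply mred_cons. Qed.

#[local] Instance dmeq_meq : subrelation dmeq meq.
Proof. intros Q P []. split; now apply mred_of_dmred. Qed.

Lemma dmeq_dual Q P : dmeq Q P -> dmeq (map qdual Q) (map qdual P).
Proof. intros []. split; now apply dmred_dual. Qed.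

Lemma dmeq_ex_ex R : dmeq (qEx :: qEx :: R) (qEx :: R).
Proof. split; [ apply dmred_ex_ex | apply dmred_ex ]. Qed.

Lemma dmeq_all_exinf R : dmeq (qAll :: qExInf :: R) (qAll :: qEx :: R).
Proof.
  split; [ apply dmred_all_exinf | apply dmred_cons, dmred_ex_exinf ].
Qed.

Lemma dmeq_all_all R : dmeq (qAll :: qAll :: R) (qAll :: R).
Proof.
  pose proof (dmeq_dual (dmeq_ex_ex (map qdual R))) as H.
  cbn in H. now rewrite map_qdual_involutive in H.
Qed.

Lemma dmeq_ex_allinf R : dmeq (qEx :: qAllInf :: R) (qEx :: qAll :: R).
Proof.
  pose proof (dmeq_dual (dmeq_all_exinf (map qdual R))) as H.
  cbn in H. now rewrite map_qdual_involutive in H.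
Qed.

(** The Σ lists are the duals of the Π lists. Level 0 does not occur, and no claim is made above
    level 3. *)
Definition normal_forms (c : level) : list (list quant) :=
  let pi2 := [[qAll; qEx]; [qExInf; qEx]; [qExInf]] in
  let pi3 :=
    [[qAll; qEx; qAll]; [qExInf; qEx; qAll]; [qExInf; qAllInf; qAll];
     [qExInf; qAllInf]; [qExInf; qAll]; [qAll; qAllInf; qAll];
     [qAll; qAllInf]] in
  match c with
  | Sigma 1 => [[qEx]]
  | Pi 1 => [[qAll]]
  | Sigma 2 => map (map qdual) pi2
  | Pi 2 => pi2
  | Sigma 3 => map (map qdual) pi3
  | Pi 3 => pi3
  | _ => []
  end.

Definition rank (c : level) : nat := match c with Sigma n | Pi n => n end.

(** Prefixing a quantifier never lowers the rank, so the tail has a normal form by induction;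
    positivity of the rank excludes level 0. *)
Lemma dmeq_normal_form Q c : has_level Q c ->
  1 <= rank c /\
  (rank c <= 3 -> exists P, In P (normal_forms c) /\ dmeq Q P).
Proof.
  induction 1 as [ q | q Q c HQ [Hpos IH] ].
  - destruct q; (split; [ cbn; lia | ]); intros _; eexists;
      (split; [ | reflexivity ]); cbn; tauto.
  - split; [ destruct q, c; cbn in *; lia | ]. intros Hle.
    destruct IH as (P & HP & HQP); [ destruct q, c; cbn in *; lia | ].
    setoid_rewrite HQP. clear HQ HQP.
    destruct c as [n | n]; destruct n as [ | [ | [ | [ | n ]]]];
      cbn in Hpos, HP; try lia; destruct q; cbn in Hle |- *; try lia;
      clear Hpos Hle;
      repeat match type of HP with
        | _ \/ _ => destruct HP as [ <- | HP ]
        | False => destruct HP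
        end;
      (* The rules merge the new quantifier with the head of the normal form and may cascade inward;
         what remains is listed. *)
      repeat first
        [ setoid_rewrite dmeq_ex_ex | setoid_rewrite dmeq_all_all
        | setoid_rewrite dmeq_all_exinf | setoid_rewrite dmeq_ex_allinf ];
      eexists; (split; [ | reflexivity ]); tauto.
Qed.

(** * Further identifications up to m-equivalence *)

Lemma meq_exinf : meq [qExInf] [qAll; qEx].
Proof. split; [ apply mred_exinf_all_ex | apply mred_all_ex ]. Qed.

Lemma meq_exinf_ex : meq [qExInf; qEx] [qAll; qEx].
Proof.
  split.
  - eapply mred_trans; [ apply mred_exinf_all_ex | ].
    apply mred_of_dmred, dmred_cons, dmred_ex_ex.
  - eapply mred_trans; [ apply mred_all_ex | ].
    apply mred_cons, mred_of_dmred, (dmred_ex []).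
Qed.

Lemma meq_exinf_ex_all : meq [qExInf; qEx; qAll] [qAll; qEx; qAll].
Proof.
  split.
  - eapply mred_trans; [ apply mred_exinf_all_ex | ].
    apply mred_of_dmred, dmred_cons, dmred_ex_ex.
  - apply mred_all_ex_all.
Qed.

Lemma meq_exinf_allinf : meq [qExInf; qAllInf] [qExInf; qAll].
Proof.
  split; [ apply mred_exinf_allinf | ].
  (* Under the leading ∃∞ this is ∀ ≤ ∀∞, the dual of padding. *)
  apply mred_cons, mred_of_dmred, (dmred_dual (dmred_ex_exinf [])).
Qed.

Lemma m_equiv_of_meq Q P : meq Q P -> m_equiv (canonical Q) (canonical P).
Proof. intros []. split; now apply m_le_of_mred. Qed.

Lemma dm_equiv_of_dmeq Q P : dmeq Q P -> dm_equiv (canonical Q) (canonical P).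
Proof. intros []. split; now apply dm_le_of_dmred. Qed.

Theorem theorem4p1 :
  (forall Q : list quant, has_level Q (Sigma 3) ->
    exists P : list quant,
      In P [ [qEx; qAll; qEx];
             [qAllInf; qExInf];
             [qAllInf; qEx] ] /\
      m_equiv (canonical Q) (canonical P)) /\
  (forall Q : list quant, has_level Q (Pi 3) ->
    exists P : list quant,
      In P [ [qAll; qEx; qAll];
             [qExInf; qAllInf; qAll];
             [qExInf; qAll];
             [qAll; qAllInf; qAll];
             [qAll; qAllInf] ] /\
      m_equiv (canonical Q) (canonical P)) /\
  (forall Q : list quant, has_level Q (Pi 3) ->
    exists P : list quant,
      In P [ [qAll; qEx; qAll];
             [qExInf; qEx; qAll];
             [qExInf; qAllInf; qAll];
             [qExInf; qAllInf];
             [qExInf; qAll];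
             [qAll; qAllInf; qAll];
             [qAll; qAllInf] ] /\
      dm_equiv (canonical Q) (canonical P)).
Proof.
  split; [ | split ]; intros Q HQ;
    destruct (dmeq_normal_form HQ) as (_ & P & HP & HQP); cbn; try lia;
    cbn in HP.
  - enough (exists P',
      In P' [[qEx; qAll; qEx]; [qAllInf; qExInf]; [qAllInf; qEx]]
      /\ meq P P') as (P' & HP' & HPP').
    { exists P'. split; [ exact HP' | ]. apply m_equiv_of_meq.
      transitivity P; [ now apply dmeq_meq | exact HPP' ]. }
    (* The Π2 tails ∃∞, ∃∞∃ and ∀∃ are m-equivalent, so the forms with one of them behind ∀∞ merge,
       and so do those behind ∃. *)
    repeat destruct HP as [ <- | HP ]; try destruct HP;
      [ exists [qEx; qAll; qEx] | exists [qAllInf; qExInf]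
      | exists [qAllInf; qExInf] | exists [qAllInf; qExInf]
      | exists [qAllInf; qEx] | exists [qEx; qAll; qEx]
      | exists [qEx; qAll; qEx] ];
      (split; [ cbn; tauto | ]);
      rewrite ?meq_exinf_ex, ?meq_exinf, ?dmeq_ex_ex; reflexivity.
  - enough (exists P', In P' [[qAll; qEx; qAll]; [qExInf; qAllInf; qAll];
      [qExInf; qAll]; [qAll; qAllInf; qAll]; [qAll; qAllInf]]
      /\ meq P P') as (P' & HP' & HPP').
    { exists P'. split; [ exact HP' | ]. apply m_equiv_of_meq.
      transitivity P; [ now apply dmeq_meq | exact HPP' ]. }
    (* Of the seven forms, ∃∞∃∀ merges with ∀∃∀ and ∃∞∀∞ with ∃∞∀. *)
    repeat destruct HP as [ <- | HP ]; try destruct HP;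
      try setoid_rewrite meq_exinf_ex_all;
      try setoid_rewrite meq_exinf_allinf;
      eexists; (split; [ | reflexivity ]); cbn; tauto.
  - exists P. split; [ exact HP | now apply dm_equiv_of_dmeq ].
Qed.
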